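(* Let $(\beta,\mathcal{A})$ be a numeration system such that $\beta$ is an algebraic integer and $\mathcal{A}[\beta]=\mathbb{Z}[\beta]$. If $(\beta,\mathcal{A})$ allows parallel addition, then $$\#\mathcal{A}\ \geq\ \max\{|m_\beta(0)|,\ |m_\beta(1)|\}.$$ Moreover, if $\beta$ has a positive real conjugate, then $$\#\mathcal{A}\ \geq\ \max\{|m_\beta(0)|,\ |m_\beta(1)|+2\}.$$
   Context: $\mathbb{N}$ contains $0$. $\mathbb{Z}[\beta]$ is the smallest ring containing $\mathbb{Z}$ and $\beta$. The monic minimal polynomial of the algebraic integer $\beta$ is denoted $m_\beta$; the conjugates of $\beta$ are all complex roots of $m_\beta$ (including $\beta$ itself). A numeration system is a pair $(\beta,\mathcal{A})$ where $\beta\in\mathbb{C}$, $|\beta|>1$ (the base), and $\mathcal{A}\subset\mathbb{C}$ is a finite set containing $0$ (the alphabet). Define $\mathcal{A}[\beta]=\{\sum_{j=0}^n x_j\beta^j : n\in\mathbb{N},\ x_j\in\mathcal{A}\}$. For alphabets $\mathcal{A},\mathcal{B}$, a function $\varphi:\mathcal{B}^{\mathbb{Z}}\to\mathcal{A}^{\mathbb{Z}}$ is $p$-local if there exist $r,t\in\mathbb{N}$ with $p=r+t+1$ and a function $\phi:\mathcal{B}^p\to\mathcal{A}$ such that for every $w=(w_j)_{j\in\mathbb{Z}}\in\mathcal{B}^{\mathbb{Z}}$ its image $z=\varphi(w)=(z_j)_{j\in\mathbb{Z}}$ satisfies $z_j=\phi(w_{j+t},\dots,w_{j-r})$ for all $j\in\mathbb{Z}$.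 A digit set conversion in base $\beta$ from $\mathcal{B}$ to $\mathcal{A}$ (alphabets containing $0$) is a function $\varphi:\mathcal{B}^{\mathbb{Z}}\to\mathcal{A}^{\mathbb{Z}}$ such that for every $w=(w_j)_{j\in\mathbb{Z}}\in\mathcal{B}^{\mathbb{Z}}$ with finitely many non-zero digits, $z=\varphi(w)$ has only finitely many non-zero digits and $\sum_{j\in\mathbb{Z}}w_j\beta^j=\sum_{j\in\mathbb{Z}}z_j\beta^j$. Parallel addition in $(\beta,\mathcal{A})$ is a digit set conversion in base $\beta$ from $\mathcal{A}+\mathcal{A}=\{a+a' : a,a'\in\mathcal{A}\}$ to $\mathcal{A}$ that is $p$-local for some $p\in\mathbb{N}$; $(\beta,\mathcal{A})$ allows parallel addition if such a function exists. *)

(* Defs.v *)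
From HB Require Import structures.
From mathcomp Require Import all_boot all_order all_algebra finmap.
From mathcomp Require Import boolp classical_sets functions cardinality fsbigop.
From mathcomp Require Import reals.
From mathcomp Require Import complex.

Set Implicit Arguments.
Unset Strict Implicit.
Unset Printing Implicit Defensive.

Import Order.TTheory GRing.Theory Num.Theory.
Local Open Scope classical_set_scope.
Local Open Scope fset_scope.
Local Open Scope ring_scope.

Section AlgebraicIntegers.
Variable C : numFieldType.
Implicit Types (beta gamma : C) (m q : {poly rat}).

Definition algebraic_integer beta := integralOver (intr : int -> C) beta.

Definition is_minpoly beta m : Prop :=
  [/\ m \is monic, root (map_poly ratr m) beta &
      forall q, q != 0 -> root (map_poly ratr q) beta -> (size m <= size q)%N].

Lemma is_minpoly_unique beta m q :
  is_minpoly beta m -> is_minpoly beta q -> m = q.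
Proof.
move=> [mm rm minm] [mq rq minq]; apply/eqP; rewrite -subr_eq0.
apply/negPn/negP => d0.
have ms : size m = size q.
  by apply/eqP; rewrite eqn_leq minm ?minq // monic_neq0.
have rd : root (map_poly ratr (m - q)) beta.
  by rewrite /root rmorphB /= hornerD hornerN (eqP rm) (eqP rq) subrr.
have := minm _ d0 rd; apply/negP; rewrite -ltnNge.
have m0 : (0 < size m)%N by rewrite size_poly_gt0 monic_neq0.
rewrite -(prednK m0) ltnS; apply/leq_sizeP => j lej.
rewrite coefB; have [/eqP ej|nej] := boolP (j == (size m).-1).
  have em := eqP mm; have eq := eqP mq.
  by move: em eq; rewrite /lead_coef -ms -ej => -> ->; rewrite subrr.
have lt : (size m <= j)%N by rewrite -(prednK m0) ltn_neqAle eq_sym nej.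
by rewrite !nth_default ?subrr // -ms.
Qed.

(* [m_beta]; the default value [0] is only taken when [beta] is not algebraic,
   by [minpolyP]. *)
Definition minpoly beta : {poly rat} := xget 0 [set m | is_minpoly beta m].

Lemma minpolyP beta :
  algebraicOver (ratr : rat -> C) beta -> is_minpoly beta (minpoly beta).
Proof.
case=> p p0 rp; rewrite /minpoly; case: xgetP => [m _ //|] none.
pose P n := `[< exists q : {poly rat},
  [/\ q != 0, root (map_poly ratr q) beta & size q = n] >].
have exP : exists n, P n by exists (size p); apply/asboolP; exists p.
case: (ex_minnP exP) => n /asboolP[q [q0 rq sq]] minn.
have lq0 : (lead_coef q)^-1 != 0 by rewrite invr_eq0 lead_coef_eq0.
case: (none ((lead_coef q)^-1 *: q)); split.
- by rewrite monicE lead_coefZ mulVf // lead_coef_eq0.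
- by rewrite map_polyZ rootZ // fmorph_eq0.
- move=> r r0 rr; rewrite size_scale // sq; apply: minn.
  by apply/asboolP; exists r.
Qed.

Definition conjugate beta gamma : Prop :=
  root (map_poly ratr (minpoly beta)) gamma.

(* [Z[beta]]: a subring contains [1], hence [Z]. *)
Definition Zadjoin beta : set C :=
  smallest (fun S : set C => subring_closed (mem S)) [set beta].

End AlgebraicIntegers.

Section NumerationSystems.
Variable C : numFieldType.
Implicit Types (beta : C) (A B : {fset C}).

Definition numeration_system beta A : Prop := 1 < `|beta| /\ 0 \in A.

(* [A[beta]] *)
Definition digit_span beta A : set C :=
  [set z | exists n (x : 'I_n.+1 -> A), z = \sum_(j < n.+1) val (x j) * beta ^+ j].

(* The window [(w_(j+t), ..., w_(j-r))] is read from left to right. *)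
Definition p_local p A B (phi : (int -> B) -> (int -> A)) : Prop :=
  exists r t : nat, p = (r + t + 1)%N /\
  exists Phi : p.-tuple B -> A, forall (w : int -> B) (j : int),
    phi w j = Phi [tuple w (j + t%:Z - (i : nat)%:Z) | i < p].

Definition finitely_many_nonzero A (w : int -> A) : Prop :=
  finite_set [set j : int | val (w j) != 0].

(* The sum over all of [int] is the sum over its finite support. *)
Definition seq_value beta A (w : int -> A) : C :=
  \sum_(j \in [set: int]) (val (w j) * beta ^ j).

Definition digit_set_conversion beta B A (phi : (int -> B) -> (int -> A)) : Prop :=
  forall w : int -> B, finitely_many_nonzero w ->
    finitely_many_nonzero (phi w) /\ seq_value beta w = seq_value beta (phi w).

Definition alphabet_add A : {fset C} := [fset a + b | a in A, b in A].

Definition allows_parallel_addition beta A : Prop :=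
  exists phi : (int -> alphabet_add A) -> (int -> A),
    digit_set_conversion beta phi /\ exists p : nat, p_local p phi.

End NumerationSystems.

(* Main.v *)
Require Import Defs.
From HB Require Import structures.
From mathcomp Require Import all_boot all_order all_algebra finmap.
From mathcomp Require Import boolp classical_sets functions cardinality fsbigop.
From mathcomp Require Import reals.
From mathcomp Require Import complex.
From mathcomp Require Import zify ring lra.

Set Implicit Arguments.
Unset Strict Implicit.
Unset Printing Implicit Defensive.

Import Order.TTheory GRing.Theory Num.Theory.
Local Open Scope classical_set_scope.
Local Open Scope fset_scope.
Local Open Scope complex_scope.
Local Open Scope ring_scope.

(** Write [f b] for the digit that the local rule outputs on the constant word
    of value [b], where [b] runs through [A + A].  Two facts about [f] follow
    from comparing the conversions of two finite words that differ by one
    letter; [r + t + 1] is the size of the window and [q = r + t].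

    - Lengthening a run of [b]'s by one letter lengthens the output by exactly
      one letter [f b], the rest being shifted, that is, multiplied by [beta].
      This gives [b * beta ^ t = f b + (beta - 1) * s] with [s] in [Z[beta]]
      ([window_conversion_constant]), so [b] and [f b] agree modulo
      [beta - 1].
    - Replacing the middle letter of a long run of [b]'s by [c] only affects
      [q + 1] output digits, all of which were [f b].  This gives
      [(c - b) * beta ^ t = sum_(i <= q) (y_i - f b) * beta ^ i] with digits
      [y_i] ([window_conversion_replace]).  Mapping [beta] to a conjugate
      [gamma > 0], all [gamma ^ i] are positive, so if the image of [f b] is
      the least among those of the digits, then the image of [b] is the least
      in [A + A]; likewise for greatest.

    The relations among elements of [Z[beta]] are turned into congruences by
    lifting to integer polynomials: one that vanishes at [beta] is a multiple
    of [m_beta], hence its value at an integer [k] is divisible by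
    [m_beta(k)], and it vanishes at every conjugate.  So reduction modulo
    [beta - k] is seen as evaluation at [k] modulo [m_beta(k)], and it is
    enough to show that the digits, evaluated at [0] and at [1], represent all
    integers modulo [m_beta(0)] and [m_beta(1)].

    Every integer has an expansion with digits in [A].  At [0] only its
    constant digit remains, which settles [m_beta(0)].  At [1] it becomes a
    sum of digits, and by the first fact the digits are closed under addition
    modulo [m_beta(1)], which settles [m_beta(1)].

    Suppose finally that [gamma > 0] is a conjugate, and let [l] and [u] be
    digits of least and greatest image.  As [-1] and [1] have expansions, the
    image of [l] is negative and that of [u] is positive.  The image of [l + l]
    is then below that of every digit [a], and that of [u + u] above it; by the
    second fact [f a] is neither [l] nor [u].  As [f a] is congruent to [a],
    the digits other than [l] and [u] already represent all integers modulo
    [m_beta(1)]. *)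

(** * The minimal polynomial of an algebraic integer *)

Lemma map_ratr_intr (C : numFieldType) (P : {poly int}) :
  map_poly ratr (map_poly intr P : {poly rat}) = map_poly intr P :> {poly C}.
Proof. by rewrite -map_poly_comp; apply: eq_map_poly => z /=; rewrite ratr_int. Qed.

Lemma algebraic_integer_algebraic (C : numFieldType) (beta : C) :
  algebraic_integer beta -> algebraicOver (ratr : rat -> C) beta.
Proof.
case=> p mp rp; exists (map_poly intr p); last by rewrite map_ratr_intr.
exact: monic_neq0 (monic_map _ mp).
Qed.

Lemma minpoly_dvdp (C : numFieldType) (beta : C) (m q : {poly rat}) :
  is_minpoly beta m -> root (map_poly ratr q) beta -> m %| q.
Proof.
move=> [mm rm minm] rq; apply/negPn/negP => nd.
have rr : root (map_poly ratr (q %% m)) beta.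
  move: rq; rewrite {1}(divp_eq q m) /root rmorphD rmorphM /= hornerD hornerM.
  by rewrite (eqP rm) mulr0 add0r.
by have := minm _ nd rr; rewrite leqNgt ltn_modp monic_neq0.
Qed.

(** Gauss's lemma: the minimal polynomial divides a monic integer polynomial, so
    it is a rational multiple of an integer polynomial whose leading
    coefficient is a unit. *)
Lemma minpoly_int (C : numFieldType) (beta : C) : algebraic_integer beta ->
  exists2 M : {poly int}, M \is monic & map_poly intr M = minpoly beta.
Proof.
move=> hb; have [p mp rp] := hb.
have hm := minpolyP (algebraic_integer_algebraic hb).
have [mm _ _] := hm.
have /dvdpP_rat_int[p1 [a a0 ea] [r er]] : minpoly beta %| map_poly intr p.
  by apply: minpoly_dvdp hm _; rewrite map_ratr_intr.
have l1 : lead_coef p1 * lead_coef r = 1 by rewrite -lead_coefM -er (monicP mp).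
have l2 : lead_coef p1 * lead_coef p1 = 1.
  have /orP[] : lead_coef p1 \is a intUnitRing.unitz.
    by apply: (@intUnitRing.unitzPl _ (lead_coef r)); rewrite mulrC.
  - by move/eqP->.
  - by move/eqP->.
exists (lead_coef p1 *: p1); first by rewrite monicE lead_coefZ l2.
have al : a * (lead_coef p1)%:~R = 1.
  have := monicP mm; rewrite ea lead_coefZ lead_coef_map_inj //.
  exact: intr_inj.
have -> : minpoly beta = a *: map_poly intr p1 by [].
rewrite map_polyZ /=; congr (_ *: _).
rewrite -[RHS]mulr1 -[X in _ = a * X](rmorph1 (intr : {rmorphism int -> rat})).
by rewrite -l2 rmorphM mulrA al mul1r.
Qed.

(** As [M] is monic, division with remainder stays within integer polynomials,
    and the remainder vanishes by minimality of the degree. *)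
Lemma int_minpoly_dvd (C : numFieldType) (beta : C) (M P : {poly int}) :
  algebraic_integer beta -> M \is monic -> map_poly intr M = minpoly beta ->
  (map_poly intr P).[beta] = 0 -> exists Q, P = Q * M.
Proof.
move=> hb mM eM rP.
have [mm rm minm] := minpolyP (algebraic_integer_algebraic hb).
have eP := Pdiv.RingMonic.rdivp_eq mM P.
set Q := Pdiv.CommonRing.rdivp P M in eP; set r := Pdiv.CommonRing.rmodp P M in eP.
exists Q; rewrite eP; suff -> : r = 0 by rewrite addr0.
apply/eqP/negPn/negP => r0.
have rr : root (map_poly ratr (map_poly intr r : {poly rat})) beta.
  have eMb : (map_poly intr M).[beta] = 0 by rewrite -map_ratr_intr eM (eqP rm).
  rewrite map_ratr_intr /root; apply/eqP; move: rP.
  by rewrite eP rmorphD rmorphM /= hornerD hornerM eMb mulr0 add0r.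
have szi (p : {poly int}) : size (map_poly intr p : {poly rat}) = size p.
  by apply: size_map_inj_poly => //; exact: intr_inj.
have rI0 : (map_poly intr r : {poly rat}) != 0.
  by rewrite -size_poly_gt0 szi size_poly_gt0.
have := minm _ rI0 rr; rewrite -eM !szi leqNgt.
by rewrite Pdiv.CommonRing.ltn_rmodpN0 // monic_neq0.
Qed.

(** * Local conversions of finite words *)

Lemma seq_value_nat (C : numFieldType) (beta : C) (A : {fset C}) (w : int -> A)
    (n : nat) :
  (forall j, val (w j) != 0 -> exists2 i, (i < n)%N & j = i%:Z) ->
  finitely_many_nonzero w /\
  seq_value beta w = \sum_(i < n) val (w i%:Z) * beta ^+ i.
Proof.
move=> hw; split.
  apply: (@sub_finite_set _ _ [set i%:Z | i in `I_n]).
    by move=> j /= /hw[i lti ->]; exists i.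
  exact/finite_image/finite_II.
rewrite /seq_value -(fsbig_widen [set i%:Z | i in `I_n]) //; last first.
  move=> j [_ nj] /=; apply/eqP; rewrite mulf_eq0; apply/orP; left.
  apply/negPn/negP => /hw[i lti ej]; apply: nj; exists i => //.
rewrite fsbig_image; last by move=> i k _ _ [].
by rewrite -(fsbig_ord _ n (fun i => val (w i%:Z) * beta ^ i%:Z)).
Qed.

(** A digit set conversion seen through its sliding window, on words that start
    at position [r + t].  The output digit at position [i + r] is read off the
    letters at positions [i, ..., i + r + t], so input and output both live on
    natural positions.  The window is encoded as a function on [nat] of which
    only the first [r + t + 1] values count. *)
Definition window_conversion (C : numFieldType) (beta : C) (B A : {fset C})
    (r t : nat) (Psi : (nat -> B) -> A) : Prop :=
  (forall u v : nat -> B, (forall k, (k <= r + t)%N -> u k = v k) ->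
     Psi u = Psi v) /\
  (forall (L : nat) (u : nat -> B),
     (forall i, ~~ (r + t <= i < r + t + L)%N -> val (u i) = 0) ->
     \sum_(0 <= i < r + t + L + (r + t)) val (u i) * beta ^+ i =
     beta ^+ r * \sum_(0 <= i < L + (r + t))
                    val (Psi (fun k => u (i + k)%N)) * beta ^+ i).

(** An infinite constant output cannot be non-zero if it has finite support, so
    a zero window yields the digit zero; this bounds the support of the
    output. *)
Lemma local_conversion_window (C : numFieldType) (beta : C) (B A : {fset C})
    (phi : (int -> B) -> (int -> A)) (p : nat) :
  0 \in B -> digit_set_conversion beta phi -> p_local p phi ->
  exists r t Psi, @window_conversion C beta B A r t Psi.
Proof.
move=> B0 conv [r [t [ep [Phi hPhi]]]].
pose zB : B := [` B0].
have Phi0 : val (Phi [tuple zB | i < p]) = 0.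
  pose w0 : int -> B := fun=> zB.
  have [fin _] : finitely_many_nonzero (phi w0) /\
      seq_value beta w0 = seq_value beta (phi w0).
    apply: conv; have [] // := @seq_value_nat C beta B w0 0.
    by move=> j; rewrite /= eqxx.
  apply/eqP/negPn/negP => nz; apply: infinite_nat.
  have := @finite_preimage _ _ _ Posz _ fin; rewrite (_ : _ @^-1` _ = setT).
    by apply=> i j _ _ [].
  by apply/seteqP; split=> // i _ /=; rewrite hPhi.
(* The window of a word over the integers is listed by decreasing position. *)
exists r, t, (fun u => Phi [tuple u (r + t - (i : nat))%N | i < p]); split.
  move=> u v uv; congr Phi; apply: eq_mktuple => i; apply: uv; lia.
move=> L u u0.
pose w (j : int) : B := if j is Posz i then u i else zB.
have wnz j : val (w j) != 0 ->
    exists2 i, (r + t <= i < r + t + L)%N & j = i%:Z.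
  case: j => i /=; last by rewrite eqxx.
  move=> nz; exists i => //; apply/negPn/negP => /u0 e0.
  by rewrite e0 eqxx in nz.
have w0 j : val (w j) = 0 -> w j = zB by move=> e; apply: val_inj.
have [fin eqw] : finitely_many_nonzero w /\
   seq_value beta w = \sum_(i < r + t + L + (r + t)) val (w i%:Z) * beta ^+ i.
  apply: seq_value_nat => j /wnz[i hi ->]; exists i => //; lia.
have phiw (i : nat) : phi w (i + r)%:Z =
    Phi [tuple u (i + (r + t - (k : nat)))%N | k < p].
  rewrite hPhi; congr Phi; apply: eq_mktuple => k.
  have kp := ltn_ord k.
  by rewrite (_ : _ - _ = (i + (r + t - k))%:Z) //; lia.
have phiw_supp j : val (phi w j) != 0 ->
    exists2 i, (i < L + (r + t))%N & j = (i + r)%:Z.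
  move=> nz.
  have [k nzk] : exists k : 'I_p, val (w (j + t%:Z - k%:Z)) != 0.
    apply: contrapT => nk; move: nz; rewrite hPhi -Phi0 => /eqP; apply.
    congr (val (Phi _)); apply: eq_mktuple => k; apply: w0.
    by apply/eqP/negPn/negP => h; apply: nk; exists k.
  have [i hi ej] := wnz _ nzk; have kp := ltn_ord k.
  exists (i + k - (r + t))%N; lia.
have [_ eqv] : finitely_many_nonzero (phi w) /\ seq_value beta (phi w) =
    \sum_(i < L + (r + t) + r) val (phi w i%:Z) * beta ^+ i.
  apply: seq_value_nat => j /phiw_supp[i hi ->]; exists (i + r)%N => //; lia.
have [_ ev] := conv _ fin; move: ev; rewrite eqw eqv -!(big_mkord xpredT
  (fun i => val (_ i%:Z) * beta ^+ i)) => ->.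
rewrite (@big_cat_nat _ _ _ r) //=; last lia.
rewrite big_nat big1 ?add0r; last first.
  move=> i ltir; have [->|/phiw_supp[k _ [ei]]] := eqVneq (val (phi w i%:Z)) 0.
    by rewrite mul0r.
  by move: ltir; rewrite ei; lia.
rewrite -{1}[r]add0n big_addn addnK mulr_sumr; apply: eq_bigr => i _.
by rewrite phiw exprD mulrA mulrC.
Qed.

(** Replacing by [c] the middle letter of the word [b ^ (2 q + 1)], with
    [q = r + t].  The run of [b]'s is just long enough for every window that
    meets the middle letter to avoid the padding zeros: on the unmodified word
    such a window outputs the constant digit.  The right-hand side therefore
    collects differences to one and the same digit, whatever the base, and no
    boundary term remains. *)
Lemma window_conversion_replace (C : numFieldType) (beta : C) (B A : {fset C})
    (r t : nat) (Psi : (nat -> B) -> A) (b c : B) :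
  beta != 0 -> 0 \in B -> window_conversion beta r t Psi ->
  exists y : nat -> A, (val c - val b) * beta ^+ t =
    \sum_(0 <= i < (r + t).+1) (val (y i) - val (Psi (fun=> b))) * beta ^+ i.
Proof.
move=> beta0 B0 [loc conv].
have [q qE] : {q | q = (r + t)%N} by exists (r + t)%N.
rewrite -qE in loc conv *.
have [L LE] : {L | L = ((q + q).+1)%N} by exists ((q + q).+1)%N.
pose zB : B := [` B0].
pose u (i : nat) := if (q <= i < q + L)%N then b else zB.
pose v (i : nat) := if i == (q + q)%N then c else u i.
have uz i : ~~ (q <= i < q + L)%N -> val (u i) = 0.
  by rewrite /u; case: ifP.
have vz i : ~~ (q <= i < q + L)%N -> val (v i) = 0.
  by move=> hi; rewrite /v; case: eqP => [ei|_]; [exfalso; lia|exact: uz].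
pose x (w : nat -> B) i := val (Psi (fun k => w (i + k)%N)).
exists (fun i => Psi (fun k => v (i + q + k)%N)).
have in_diff : \sum_(0 <= i < q + L + q) (val (v i) - val (u i)) * beta ^+ i =
    (val c - val b) * beta ^+ (q + q).
  rewrite (big_cat_nat _ (n := (q + q)%N)) //=; last lia.
  rewrite [X in X + _]big_nat big1 ?add0r => [|i hi]; last first.
    by rewrite /v; case: eqP => [ei|_]; [exfalso; lia|rewrite subrr mul0r].
  rewrite big_ltn; last lia.
  rewrite big_nat big1 ?addr0 => [|i hi]; last first.
    by rewrite /v; case: eqP => [ei|_]; [exfalso; lia|rewrite subrr mul0r].
  by rewrite /v eqxx /u; case: ifP => // /negP[]; lia.
have out_diff : \sum_(0 <= i < L + q) (x v i - x u i) * beta ^+ i =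
    beta ^+ q *
    \sum_(0 <= i < q.+1) (x v (i + q)%N - val (Psi (fun=> b))) * beta ^+ i.
  have far i : (i < q)%N || (q + q < i)%N -> (x v i - x u i) * beta ^+ i = 0.
    move=> hi; rewrite (_ : x v i = x u i) ?subrr ?mul0r //; congr val.
    by apply: loc => k kq; rewrite /v; case: eqP => // ?; exfalso; lia.
  rewrite (big_cat_nat _ (n := q)) //=; last lia.
  rewrite [X in X + _]big_nat big1 ?add0r => [|i hi]; last by apply: far; lia.
  rewrite (big_cat_nat _ (n := L)) //=; try lia.
  rewrite [X in _ + X = _](_ : _ = 0) ?addr0; last first.
    by rewrite big_nat big1 // => i hi; apply: far; lia.
  rewrite -{1}[q]add0n big_addn LE -addSn addnK mulr_sumr.
  apply: eq_big_nat => i hi; rewrite exprD mulrA mulrC; congr (_ * ((_ - _) * _)).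
  congr val; apply: loc => k kq; rewrite /u; case: ifP => // /negP[]; lia.
have key : (val c - val b) * beta ^+ (q + q) = beta ^+ r * (beta ^+ q *
    \sum_(0 <= i < q.+1) (x v (i + q)%N - val (Psi (fun=> b))) * beta ^+ i).
  have split n (f g : nat -> C) : \sum_(0 <= i < n) (f i - g i) * beta ^+ i =
      \sum_(0 <= i < n) f i * beta ^+ i - \sum_(0 <= i < n) g i * beta ^+ i.
    by rewrite -sumrB; apply: eq_bigr => i _; rewrite mulrBl.
  rewrite -in_diff -out_diff (split _ (fun i => val (v i))) (split _ (x v)).
  by rewrite mulrBr !conv.
apply: (mulfI (expf_neq0 (r + q) beta0)).
rewrite mulrCA -exprD (_ : r + q + t = q + q)%N; last lia.
by rewrite key mulrA -exprD.
Qed.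

(** Comparison of the words [b ^ q] and [b ^ (q + 1)], with [q = r + t].  The
    output of the longer word is that of the shorter one with a digit
    [Psi (fun=> b)] inserted at position [q]; the digits above it move up by
    one position, hence the factor [beta - 1]. *)
Lemma window_conversion_constant (C : numFieldType) (beta : C) (B A : {fset C})
    (r t : nat) (Psi : (nat -> B) -> A) (b : B) :
  beta != 0 -> 0 \in B -> window_conversion beta r t Psi ->
  exists y : nat -> A, val b * beta ^+ t =
    val (Psi (fun=> b)) +
    (beta - 1) * \sum_(0 <= i < r + t) val (y i) * beta ^+ i.
Proof.
move=> beta0 B0 [loc conv].
have [q qE] : {q | q = (r + t)%N} by exists (r + t)%N.
rewrite -qE in loc conv *.
pose zB : B := [` B0].
pose u (L i : nat) := if (q <= i < q + L)%N then b else zB.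
have uz L i : ~~ (q <= i < q + L)%N -> val (u L i) = 0.
  by rewrite /u; case: ifP.
pose x L i := val (Psi (fun k => u L (i + k)%N)).
have input L : \sum_(0 <= i < q + L + q) val (u L i) * beta ^+ i =
    \sum_(q <= i < q + L) val b * beta ^+ i.
  rewrite (big_cat_nat _ (n := (q + L)%N)) //=; last lia.
  rewrite (big_cat_nat _ (n := q)) //=; last lia.
  rewrite [X in X + _ + _](_ : _ = 0) ?add0r; last first.
    by rewrite big_nat big1 // => i hi; rewrite uz ?mul0r //; lia.
  rewrite [X in _ + X = _](_ : _ = 0) ?addr0; last first.
    by rewrite big_nat big1 // => i hi; rewrite uz ?mul0r //; lia.
  by apply: eq_big_nat => i hi; rewrite /u hi.
have x_left i : (i < q)%N -> x q.+1 i = x q i.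
  move=> hi; congr val; apply: loc => k kq; rewrite /u.
  by rewrite (_ : (q <= i + k < q + q.+1) = (q <= i + k < q + q))%N //; lia.
have x_mid : x q.+1 q = val (Psi (fun=> b)).
  congr val; apply: loc => k kq; rewrite /u.
  by rewrite (_ : (q <= q + k < q + q.+1) = true)%N //; lia.
have x_right i : (q <= i)%N -> x q.+1 i.+1 = x q i.
  move=> hi; congr val; apply: loc => k kq; rewrite /u.
  by rewrite (_ : (q <= i.+1 + k < q + q.+1) = (q <= i + k < q + q))%N //; lia.
exists (fun i => Psi (fun k => u q (i + q + k)%N)).
have output : \sum_(0 <= i < q.+1 + q) x q.+1 i * beta ^+ i -
    \sum_(0 <= i < q + q) x q i * beta ^+ i = beta ^+ q *
    (val (Psi (fun=> b)) + (beta - 1) * \sum_(0 <= i < q) x q (i + q)%N * beta ^+ i).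
  rewrite (big_cat_nat _ (n := q)) //=; last lia.
  rewrite [X in _ - X](big_cat_nat _ (n := q)) //=; last lia.
  rewrite (eq_big_nat _ _ (F2 := fun i => x q i * beta ^+ i)); last first.
    by move=> i hi; rewrite x_left.
  rewrite (@big_ltn _ _ _ q (q.+1 + q)); last lia.
  rewrite opprD addrACA subrr add0r x_mid addSn big_add1 /=.
  rewrite -addrA mulrDr [beta ^+ q * _]mulrC; congr (_ + _).
  rewrite -sumrB -{1}[q]add0n big_addn addnK mulrA mulr_sumr.
  apply: eq_big_nat => i hi; rewrite x_right; last lia.
  rewrite exprS exprD; ring.
have key : val b * beta ^+ (q + q) = beta ^+ r * (beta ^+ q *
    (val (Psi (fun=> b)) + (beta - 1) * \sum_(0 <= i < q) x q (i + q)%N * beta ^+ i)).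
  rewrite -output mulrBr -!conv; try by move=> i; exact: uz.
  rewrite !input addnS big_nat_recr ?leq_addr //= [RHS]addrC addKr //. 
apply: (mulfI (expf_neq0 (r + q) beta0)).
rewrite mulrCA -exprD (_ : r + q + t = q + q)%N; last lia.
by rewrite key mulrA -exprD.
Qed.

(** * The ring generated by the base *)

Lemma Zadjoin_poly (C : numFieldType) (beta z : C) :
  Zadjoin beta z -> exists P : {poly int}, (map_poly intr P).[beta] = z.
Proof.
apply: (@smallest_sub _ _ _ [set z | exists P : {poly int},
  (map_poly intr P).[beta] = z]); last first.
  by move=> _ ->; exists 'X; rewrite map_polyX hornerX.
split; first by rewrite inE; exists 1; rewrite rmorph1 hornerC.
- move=> u v; rewrite !inE => -[P <-] [Q <-]; exists (P - Q).
  by rewrite rmorphB hornerD hornerN.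
- move=> u v; rewrite !inE => -[P <-] [Q <-]; exists (P * Q).
  by rewrite rmorphM hornerM.
Qed.

Lemma Zadjoin_int (C : numFieldType) (beta : C) (k : int) : Zadjoin beta k%:~R.
Proof.
move=> S /= [[S1 SB _] _].
have SN u : u \in mem S -> - u \in mem S.
  move=> Su; rewrite -sub0r; apply: (SB) => //.
  by rewrite -(subrr 1); apply: SB.
have Sn (n : nat) : n%:R \in mem S.
  elim: n => [|n IH]; first by rewrite mulr0n -(subrr 1); apply: SB.
  by rewrite -addn1 natrD -[1%:R]opprK; apply: SB => //; apply: SN.
by rewrite -in_setE; case: k => n; [exact: Sn | apply: SN; exact: Sn].
Qed.

Lemma Zadjoin_add (C : numFieldType) (beta x y : C) :
  Zadjoin beta x -> Zadjoin beta y -> Zadjoin beta (x + y).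
Proof.
move=> Zx Zy S hS; have [[S1 SB _] _] := hS.
have {}Zx : x \in mem S by apply/mem_set/(Zx S).
have {}Zy : y \in mem S by apply/mem_set/(Zy S).
rewrite -in_setE -[y]opprK -[- y]sub0r; apply: (SB) => //; apply: (SB) => //.
by rewrite -(subrr 1); apply: SB.
Qed.

Lemma digit_Zadjoin (C : numFieldType) (beta a : C) (A : {fset C}) :
  digit_span beta A = Zadjoin beta -> a \in A -> Zadjoin beta a.
Proof.
move=> <- aA; exists 0%N, (fun=> [` aA]).
by rewrite big_ord1 expr0 mulr1.
Qed.

Lemma leq_card_residues (T : finType) (S : {set T}) (f : T -> int) (n : int) :
  (forall k : nat, exists2 a, a \in S & (n %| k%:Z - f a)%Z) -> (`|n| <= #|S|)%N.
Proof.
move=> hS; have [g gP] := choice (fun k : nat => let: ex_intro2 a aS na := hS k in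
  ex_intro (fun a => a \in S /\ (n %| k%:Z - f a)%Z) a (conj aS na)).
have inj_g : injective (fun k : 'I_`|n| => g k).
  move=> j k ejk; apply: val_inj => /=.
  have [_ nj] := gP j; have [_ nk] := gP k; rewrite -ejk in nk.
  have := rpredB nj nk; rewrite opprB addrA subrK => njk.
  have ltj := ltn_ord j; have ltk := ltn_ord k.
  have /dvdzP[q eq] := njk.
  have [q0|q0] := eqVneq q 0; first by move: eq; rewrite q0; lia.
  nia.
rewrite -[X in (X <= _)%N]card_ord -(card_imset predT inj_g).
by apply/subset_leq_card/fintype.subsetP => a /imsetP[k _ ->]; case: (gP k).
Qed.

(** * Digits represent all residues *)

Section ParallelAdditionDigits.

(* [rep z] is a chosen integer polynomial with value [z] at [beta].  Different
   choices for [rep z] have congruent values at [k] modulo [M.[k]] and the same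
   value at each conjugate of [beta]. *)
Variables (C : numFieldType) (beta : C) (M : {poly int}) (rep : C -> {poly int}).
Hypotheses (hint : algebraic_integer beta) (M_monic : M \is monic)
  (M_minpoly : map_poly intr M = minpoly beta)
  (rep_spec : forall z, Zadjoin beta z -> (map_poly intr (rep z)).[beta] = z).

(** Evaluation at [k] modulo [m_beta(k)] is a well-defined ring morphism on
    [Z[beta]]: it is reduction modulo [beta - k]. *)
Lemma horner_int_dvd (P : {poly int}) (k : int) :
  (map_poly intr P).[beta] = 0 -> (M.[k] %| P.[k])%Z.
Proof.
move=> /(int_minpoly_dvd hint M_monic M_minpoly)[Q ->].
by rewrite hornerM dvdz_mull.
Qed.

Lemma horner_conjugate (F : numFieldType) (gamma : F) (P : {poly int}) :
  (map_poly intr M).[gamma] = 0 -> (map_poly intr P).[beta] = 0 ->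
  (map_poly intr P).[gamma] = 0.
Proof.
move=> M0 /(int_minpoly_dvd hint M_monic M_minpoly)[Q ->].
by rewrite rmorphM hornerM M0 mulr0.
Qed.

Variable A : {fset C}.
Hypothesis hspan : digit_span beta A = Zadjoin beta.

Let rep_A (a : A) : (map_poly intr (rep (val a))).[beta] = val a.
Proof. exact: rep_spec (digit_Zadjoin hspan (valP a)). Qed.

Lemma int_digit_expansion (k : int) : exists n (x : 'I_n.+1 -> A),
  (map_poly intr (k%:P - \sum_(j < n.+1) rep (val (x j)) * 'X^j)).[beta] = 0.
Proof.
have : Zadjoin beta k%:~R by exact: Zadjoin_int.
rewrite -hspan => -[n [x ek]]; exists n, x.
rewrite rmorphB /= map_polyC hornerD hornerN hornerC /= ek rmorph_sum horner_sum.
apply/eqP; rewrite subr_eq0; apply/eqP; apply: eq_bigr => j _.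
by rewrite rmorphM /= map_polyXn hornerM hornerXn rep_A.
Qed.

(** The constant digit of an expansion of [k] is congruent to [k]. *)
Lemma leq_minpoly0_card : (`|M.[0]%R| <= #|` A|)%N.
Proof.
rewrite cardfE -cardsT.
apply: (leq_card_residues (f := fun a : A => (rep (val a)).[0])) => k.
have [n [x /(horner_int_dvd 0)]] := int_digit_expansion k%:Z.
rewrite hornerD hornerN hornerC horner_sum big_ord_recl big1 ?addr0.
  by rewrite hornerM hornerXn expr0 mulr1; exists (x ord0).
by move=> j _; rewrite hornerM hornerXn expr0n mulr0.
Qed.

Hypotheses (beta_neq0 : beta != 0) (A0 : 0 \in A).
Let B := alphabet_add A.
Variables (r t : nat) (Psi : (nat -> B) -> A).
Hypothesis hPsi : window_conversion beta r t Psi.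

Let digit_add (a a' : A) : exists b : B, val b = val a + val a'.
Proof.
have h : val a + val a' \in B by apply: in_imfset2; exact: valP.
by exists [` h].
Qed.

Let B0 : 0 \in B.
Proof. by rewrite -[0]addr0; exact: in_imfset2. Qed.

Let rep_B (b : B) : (map_poly intr (rep (val b))).[beta] = val b.
Proof.
apply: rep_spec; have /imfset2P[a aA [a' a'A ->]] := valP b.
by apply: Zadjoin_add; exact: digit_Zadjoin hspan _.
Qed.

Lemma constant_window_congr (b : B) :
  (M.[1] %| (rep (val b)).[1] - (rep (val (Psi (fun=> b)))).[1])%Z.
Proof.
have [y ey] := window_conversion_constant b beta_neq0 B0 hPsi.
pose P := rep (val b) * 'X^t - rep (val (Psi (fun=> b))) -
  ('X - 1) * \sum_(0 <= i < r + t) rep (val (y i)) * 'X^i.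
have -> : (rep (val b)).[1] - (rep (val (Psi (fun=> b)))).[1] = P.[1].
  by rewrite /P !hornerE expr1n mulr1.
apply: horner_int_dvd.
rewrite /P !(rmorphB, rmorphM, rmorph1) /= map_polyXn map_polyX rmorph_sum.
rewrite !hornerE rep_A rep_B ey horner_sum.
rewrite [X in _ - _ * X](eq_bigr (fun i => val (y i) * beta ^+ i)).
  by ring.
by move=> i _; rewrite rmorphM /= map_polyXn hornerM hornerXn rep_A.
Qed.

Lemma constant_window_conjugate (F : numFieldType) (gamma : F) (b c : B) :
  (map_poly intr M).[gamma] = 0 ->
  let ev z := (map_poly intr (rep z)).[gamma] in
  exists y : nat -> A, (ev (val c) - ev (val b)) * gamma ^+ t =
    \sum_(0 <= i < (r + t).+1)
      (ev (val (y i)) - ev (val (Psi (fun=> b)))) * gamma ^+ i.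
Proof.
move=> M0 ev.
have [y ey] := window_conversion_replace b c beta_neq0 B0 hPsi.
exists y; apply/eqP; rewrite -subr_eq0; apply/eqP.
pose P := (rep (val c) - rep (val b)) * 'X^t - \sum_(0 <= i < (r + t).+1)
  (rep (val (y i)) - rep (val (Psi (fun=> b)))) * 'X^i.
have PE (K : numFieldType) (x : K) : (map_poly intr P).[x] =
    ((map_poly intr (rep (val c))).[x] - (map_poly intr (rep (val b))).[x])
      * x ^+ t - \sum_(0 <= i < (r + t).+1) ((map_poly intr (rep (val (y i)))).[x]
        - (map_poly intr (rep (val (Psi (fun=> b))))).[x]) * x ^+ i.
  rewrite /P rmorphB rmorphM rmorphB /= map_polyXn rmorph_sum !hornerE horner_sum.
  congr (_ - _); apply: eq_bigr => i _.
  by rewrite rmorphM rmorphB /= map_polyXn !hornerE.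
rewrite -PE; apply: horner_conjugate => //; rewrite PE !rep_B ey.
apply/eqP; rewrite subr_eq0; apply/eqP/eq_bigr => i _.
by rewrite !rep_A.
Qed.

(** All terms on the right-hand side of [constant_window_conjugate] have the
    same sign. *)
Lemma constant_window_min (F : numFieldType) (gamma : F) (b c : B) :
  (map_poly intr M).[gamma] = 0 -> 0 < gamma ->
  let ev z := (map_poly intr (rep z)).[gamma] in
  (forall a : A, ev (val (Psi (fun=> b))) <= ev (val a)) ->
  ev (val b) <= ev (val c).
Proof.
move=> M0 g0 ev min_b; have [y ey] := constant_window_conjugate b c M0.
rewrite -subr_ge0 -(pmulr_lge0 _ (exprn_gt0 t g0)) ey.
apply: sumr_ge0 => i _.
rewrite mulr_ge0 ?exprn_ge0 ?(ltW g0) // subr_ge0; exact: min_b.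
Qed.

Lemma constant_window_max (F : numFieldType) (gamma : F) (b c : B) :
  (map_poly intr M).[gamma] = 0 -> 0 < gamma ->
  let ev z := (map_poly intr (rep z)).[gamma] in
  (forall a : A, ev (val a) <= ev (val (Psi (fun=> b)))) ->
  ev (val c) <= ev (val b).
Proof.
move=> M0 g0 ev max_b; have [y ey] := constant_window_conjugate b c M0.
rewrite -subr_le0 -(pmulr_lle0 _ (exprn_gt0 t g0)) ey.
apply: sumr_le0 => i _.
rewrite mulr_le0_ge0 ?exprn_ge0 ?(ltW g0) // subr_le0; exact: max_b.
Qed.

Lemma constant_sum_congr (a a' : A) : exists2 b : B, val b = val a + val a' &
  (M.[1] %| (rep (val a)).[1] + (rep (val a')).[1]
            - (rep (val (Psi (fun=> b)))).[1])%Z.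
Proof.
have [b eb] := digit_add a a'; exists b => //.
have sum_congr : (M.[1] %| (rep (val a)).[1] + (rep (val a')).[1]
    - (rep (val b)).[1])%Z.
  rewrite -hornerD -hornerN -hornerD; apply: horner_int_dvd.
  by rewrite !(rmorphB, rmorphD) /= !hornerE !rep_A rep_B eb subrr.
have := rpredD sum_congr (constant_window_congr b).
by rewrite addrA subrK.
Qed.

(** Modulo [beta - 1] an expansion becomes a sum of digits, which collapses to a
    single digit because digits are closed under addition up to congruence. *)
Lemma digit_residue (k : int) : exists a : A, (M.[1] %| k - (rep (val a)).[1])%Z.
Proof.
have [n [x /(horner_int_dvd 1)]] := int_digit_expansion k.
rewrite hornerD hornerN hornerC horner_sum => hk.
have sum_digits (m : nat) (y : 'I_m -> A) : exists a : A,
    (M.[1] %| \sum_(j < m) (rep (val (y j))).[1] - (rep (val a)).[1])%Z.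
  elim: m y => [|m IH] y.
    exists [` A0]; rewrite big_ord0 sub0r -hornerN; apply: horner_int_dvd.
    by rewrite rmorphN hornerN rep_A oppr0.
  have [a ha] := IH (fun j => y (widen_ord (leqnSn m) j)).
  have [b _ hb] := constant_sum_congr a (y ord_max).
  exists (Psi (fun=> b)); rewrite big_ord_recr /=.
  have := rpredD ha hb; congr (_ %| _)%Z; ring.
have [a ha] := sum_digits _ x; exists a; have := rpredD hk ha.
congr (_ %| _)%Z; rewrite (eq_bigr (fun j => (rep (val (x j))).[1])).
  by ring.
by move=> j _; rewrite hornerM hornerXn expr1n mulr1.
Qed.

Lemma leq_minpoly1_card : (`|M.[1]%R| <= #|` A|)%N.
Proof.
rewrite cardfE -cardsT.
apply: (leq_card_residues (f := fun a : A => (rep (val a)).[1])) => k.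
by have [a ha] := digit_residue k; exists a.
Qed.

(** If the digits had images of only one sign, so would all expansions, but both
    [-1] and [1] have one. *)
Lemma digit_signs (F : realFieldType) (gamma : F) :
  (map_poly intr M).[gamma] = 0 -> 0 < gamma ->
  (exists a : A, (map_poly intr (rep (val a))).[gamma] < 0) /\
  (exists a : A, 0 < (map_poly intr (rep (val a))).[gamma]).
Proof.
move=> M0 g0.
have expansion (k : int) : exists n (x : 'I_n.+1 -> A), k%:~R =
    \sum_(j < n.+1) (map_poly intr (rep (val (x j)))).[gamma] * gamma ^+ j.
  have [n [x /(horner_conjugate M0)]] := int_digit_expansion k.
  rewrite rmorphB /= map_polyC hornerD hornerN hornerC /= rmorph_sum horner_sum.
  move=> /eqP; rewrite subr_eq0 => /eqP ek; exists n, x; rewrite ek.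
  by apply: eq_bigr => j _; rewrite rmorphM /= map_polyXn hornerM hornerXn.
have g_ge0 j : 0 <= gamma ^+ j by rewrite exprn_ge0 // ltW.
split; apply: contrapT => none.
- have [n [x ek]] := expansion (-1).
  suff : 0 <= (-1)%:~R :> F by rewrite rmorphN1 oppr_ge0 ler10.
  rewrite ek; apply: sumr_ge0 => j _; rewrite mulr_ge0 // leNgt.
  by apply/negP => h; apply: none; exists (x j).
- have [n [x ek]] := expansion 1.
  suff : 1%:~R <= 0 :> F by rewrite ler10.
  rewrite ek; apply: sumr_le0 => j _; rewrite mulr_le0_ge0 // leNgt.
  by apply/negP => h; apply: none; exists (x j).
Qed.

(** The two digits of extreme image under the embedding [beta |-> gamma] can be
    spared: every digit [a] is congruent to the output on the constant word of
    value [a = a + 0], and this output is never extreme, since the images of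
    the elements of [A + A] range strictly beyond those of the digits on both
    sides. *)
Lemma leq_minpoly1_card_add2 (F : realFieldType) (gamma : F) :
  (map_poly intr M).[gamma] = 0 -> 0 < gamma -> (`|M.[1]%R| + 2 <= #|` A|)%N.
Proof.
move=> M0 g0; pose ev z := (map_poly intr (rep z)).[gamma].
have [[an an_lt0] [ap ap_gt0]] := digit_signs M0 g0.
have [l _ lP] := arg_minP (fun a : A => ev (val a)) (erefl : xpredT an).
have [u _ uP] := arg_maxP (fun a : A => ev (val a)) (erefl : xpredT ap).
have l_min (a : A) : ev (val l) <= ev (val a) by exact: (lP a isT).
have u_max (a : A) : ev (val a) <= ev (val u) by exact: (uP a isT).
have l0 : ev (val l) < 0 := le_lt_trans (l_min an) an_lt0.
have u0 : 0 < ev (val u) := lt_le_trans ap_gt0 (u_max ap).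
have ev0 : ev 0 = 0.
  by apply: horner_conjugate => //; exact: (rep_A [` A0]).
have ev_add (b : B) (a a' : A) : val b = val a + val a' ->
    ev (val b) = ev (val a) + ev (val a').
  move=> eb; apply/eqP; rewrite -subr_eq0 opprD addrA; apply/eqP.
  have : (map_poly intr (rep (val b) - rep (val a) - rep (val a'))).[gamma] = 0.
    apply: horner_conjugate => //.
    by rewrite !rmorphB /= !hornerE !rep_A rep_B eb; ring.
  by rewrite !rmorphB /= !hornerE.
have [bl ebl] := digit_add l l.
have [bu ebu] := digit_add u u.
have avoid (b : B) (a : A) : val b = val a + 0 -> Psi (fun=> b) \notin [set l; u]%SET.
  move=> eb; have evb : ev (val b) = ev (val a).
    by rewrite (ev_add b a [` A0]) //= -/(ev 0) ev0 addr0.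
  rewrite finset.in_set2; apply/norP; split; apply/eqP => eP.
  - have : ev (val b) <= ev (val bl).
      by apply: constant_window_min => // a'; rewrite eP; exact: l_min.
    rewrite evb (ev_add _ _ _ ebl); have := l_min a; lra.
  - have : ev (val bu) <= ev (val b).
      by apply: constant_window_max => // a'; rewrite eP; exact: u_max.
    rewrite evb (ev_add _ _ _ ebu); have := u_max a; lra.
have lu : l != u by apply/eqP => e; move: l0 u0; rewrite e; lra.
have := cardsC [set l; u]%SET; rewrite cards2 lu cardfE => <-.
rewrite addnC leq_add2l.
apply: (leq_card_residues (f := fun a : A => (rep (val a)).[1])) => k.
have [a ha] := digit_residue k; have [b eb hb] := constant_sum_congr a [` A0].
exists (Psi (fun=> b)); first by rewrite finset.in_setC (avoid b a eb).
have zero_congr : (M.[1] %| (rep 0).[1])%Z.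
  by apply: horner_int_dvd; exact: (rep_A [` A0]).
have := rpredB (rpredD ha hb) zero_congr; congr (_ %| _)%Z.
by rewrite /=; ring.
Qed.

End ParallelAdditionDigits.

(** * The lower bounds *)

Theorem theorem3p11 (R : realType) (beta : R[i]) (A : {fset R[i]})
  (hsys : numeration_system beta A)
  (hint : algebraic_integer beta)
  (hspan : digit_span beta A = Zadjoin beta)
  (hpar : allows_parallel_addition beta A) :
  Num.max `|(minpoly beta).[0]| `|(minpoly beta).[1]| <= (#|` A|)%:R
  /\ ((exists2 x : R, 0 < x & conjugate beta x%:C) ->
      Num.max `|(minpoly beta).[0]| (`|(minpoly beta).[1]| + 2) <= (#|` A|)%:R).
Proof.
have [beta_gt1 A0] := hsys.
have beta_neq0 : beta != 0 by rewrite -normr_gt0 (lt_trans ltr01).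
have [M M_monic M_minpoly] := minpoly_int hint.
have [rep rep_spec] : exists rep : R[i] -> {poly int},
    forall z, Zadjoin beta z -> (map_poly intr (rep z)).[beta] = z.
  suff /choice[rep hrep] : forall z, exists P : {poly int},
    Zadjoin beta z -> (map_poly intr P).[beta] = z by exists rep.
  move=> z; have [/Zadjoin_poly[P eP]|nz] := pselect (Zadjoin beta z).
    by exists P.
  by exists 0.
have B0 : 0 \in alphabet_add A by rewrite -[0]addr0; exact: in_imfset2.
have [phi [conv [p loc]]] := hpar.
have [r [t [Psi hPsi]]] := local_conversion_window B0 conv loc.
have normM (k : int) : `|(minpoly beta).[k%:~R]| = (`|M.[k]|%N)%:R :> rat.
  by rewrite -M_minpoly horner_map -intr_norm natr_absz.
have le0 : `|(minpoly beta).[0]| <= #|` A|%:R :> rat.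
  rewrite (normM 0) ler_nat.
  exact: (leq_minpoly0_card hint M_monic M_minpoly rep_spec hspan).
split=> [|[x x_gt0 x_conj]]; rewrite ge_max le0 /=.
  rewrite (normM 1) ler_nat.
  exact: (leq_minpoly1_card hint M_monic M_minpoly rep_spec hspan beta_neq0 A0 hPsi).
rewrite (normM 1) -natrD ler_nat.
apply: (leq_minpoly1_card_add2 hint M_monic M_minpoly rep_spec hspan beta_neq0 A0
  hPsi (gamma := x)) => //.
move: x_conj; rewrite /conjugate -M_minpoly map_ratr_intr /root.
rewrite (_ : map_poly intr M = map_poly (real_complex R) (map_poly intr M)).
  by rewrite horner_map fmorph_eq0 => /eqP.
by rewrite -map_poly_comp; apply: eq_map_poly => z /=; rewrite rmorph_int.
Qed.
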